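(* Suppose $p \colon \mathbb{C}^n \to \mathbb{C}^N$ is a polynomial map which restricts to a proper map of $\mathbb{B}_n$ to $\mathbb{B}_N$. Suppose that at least one of the following holds: (i) $p(0)=0$, or (ii) $p = p_0 + p_1 + \cdots +p_d$ is the decomposition of $p$ into homogeneous parts ($p_j$ homogeneous of degree $j$, $d=\deg p$) and $p_d$ is not zero at any point of the unit sphere. Then $\lVert p(z)\rVert \to \infty$ as $\lVert z\rVert\to\infty$.
   Context: $\mathbb{B}_n = \{z \in \mathbb{C}^n : \lVert z\rVert < 1\}$ is the open unit ball; the unit sphere is $S^{2n-1}=\{z\in\mathbb{C}^n:\lVert z\rVert=1\}$. A continuous map is proper if preimages of compact sets are compact. *)

(* Defs.v *)
From HB Require Import structures.
From mathcomp Require Import all_boot all_order all_algebra.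
From mathcomp Require Import all_classical all_reals all_analysis.
From mathcomp Require Import complex.
(* The notations of mpoly clash with those of the analysis library. *)
From mathcomp Require Import -(notations) mpoly.

Set Implicit Arguments.
Unset Strict Implicit.
Unset Printing Implicit Defensive.
Import Order.TTheory GRing.Theory Num.Theory.
Import numFieldNormedType.Exports.
Local Open Scope classical_set_scope.
Local Open Scope ring_scope.

(* C carries the metric topology of its modulus, as does every numFieldType. *)
HB.instance Definition _ (R : realType) :=
  NormedModule.copy R[i] (R[i] : numFieldType)^o.

(* The Euclidean norm; the norm `|z| inherited by row vectors is the sup norm,
   which induces the same topology but not the same unit ball. *)
Definition enorm (R : realType) (n : nat) (z : 'rV[R[i]]_n) : R :=
  Num.sqrt (\sum_(j < n) Normc.normc (z ord0 j) ^+ 2).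

Definition uball (R : realType) (n : nat) : set 'rV[R[i]]_n :=
  [set z | enorm z < 1].

Definition usphere (R : realType) (n : nat) : set 'rV[R[i]]_n :=
  [set z | enorm z = 1].

(* K ranges over subsets of B: compactness of a subset does not depend on
   whether it is computed in the subspace or in the ambient space. *)
Definition proper_map (T U : topologicalType) (A : set T) (B : set U)
    (f : T -> U) : Prop :=
  [/\ {within A, continuous f},
      {homo f : x / A x >-> B x} &
      forall K : set U, K `<=` B -> compact K -> compact (A `&` f @^-1` K)].

(* A polynomial map C^n -> C^N is given by its N coordinate polynomials. *)
Definition polymap (R : realType) (n N : nat) (p : 'I_N -> mpoly n R[i])
    (z : 'rV[R[i]]_n) : 'rV[R[i]]_N :=
  \row_i meval (fun j => z ord0 j) (p i).

(* mmeasure mdeg (msize) is one more than the total degree, and 0 for 0. *)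
Definition pdeg (R : realType) (n N : nat) (p : 'I_N -> mpoly n R[i]) : nat :=
  (\max_(i < N) (mmeasure mdeg (p i)).-1)%N.

Definition hompart (R : realType) (n N : nat) (k : nat)
    (p : 'I_N -> mpoly n R[i]) : 'I_N -> mpoly n R[i] :=
  fun i => pihomog mdeg k (p i).

Definition at_infinity (R : realType) (n : nat) : set_system 'rV[R[i]]_n :=
  filter_from setT (fun r : R => [set z | r < enorm z]).

#[export] Instance at_infinity_filter (R : realType) (n : nat) :
  Filter (@at_infinity R n).
Proof.
apply: filter_from_filter; first by exists 0.
move=> a b _ _; exists (Num.max a b) => // z /=.
by rewrite gt_max => /andP[].
Qed.

Lemma polymap_hompart (R : realType) (n N : nat) (p : 'I_N -> mpoly n R[i])
    (z : 'rV[R[i]]_n) :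
  polymap p z = \sum_(k < (pdeg p).+1) polymap (hompart k p) z.
Proof.
apply/rowP=> i; rewrite summxE mxE.
rewrite {1}(@pihomog_partitionE _ _ mdeg (pdeg p).+1 (p i)).
  by rewrite raddf_sum; apply: eq_bigr => k _; rewrite mxE.
have := @leq_bigmax _ (fun i => (mmeasure mdeg (p i)).-1) i.
by rewrite -/(pdeg p); case: (mmeasure mdeg (p i)).
Qed.

(* Main.v *)
Require Import Defs.
From mathcomp Require Import all_boot all_order all_algebra.
From mathcomp Require Import all_classical all_reals all_analysis.
From mathcomp Require Import complex.
From mathcomp Require Import -(notations) mpoly.
From mathcomp Require Import lra.

Set Implicit Arguments.
Unset Strict Implicit.
Unset Printing Implicit Defensive.
Import Order.TTheory GRing.Theory Num.Theory.
Import numFieldNormedType.Exports.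
Local Open Scope classical_set_scope.
Local Open Scope ring_scope.

(* Properness forces |p| = 1 on the unit sphere. For a unit vector u, the
   rational function c |-> <p(c u), p(u / conj c)> then equals 1 on the unit
   circle, hence for every c <> 0. If p(0) = 0, taking c = |z| large makes the
   second factor tend to p(0) = 0 uniformly in u, so the first one blows up.
   If p_d has no zero on the sphere, then it is bounded below there by
   compactness and dominates the terms of lower degree; d > 0 since a constant
   map is not proper. *)

(** * Moduli, the Euclidean norm and continuity *)

Lemma normr_normc (R : realType) (z : R[i]) : `|z| = (Normc.normc z)%:C%C.
Proof. by rewrite normc_def; case: z. Qed.

Lemma normc_ge0 (R : realType) (z : R[i]) : 0 <= Normc.normc z.
Proof. by case: z => a b; exact: sqrtr_ge0. Qed.

Lemma normc_real (R : realType) (t : R) : Normc.normc t%:C%C = `|t|.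
Proof. by rewrite /Normc.normc /= expr0n /= addr0 sqrtr_sqr. Qed.

Lemma normc_continuous (R : realType) :
  continuous (@Normc.normc R : R[i] -> R).
Proof.
move=> z; apply: (iffRL (@cvgrPdist_lt _ _ _ _ (nbhs_filter z) _ _)) => e e0.
apply/nbhs_ballP; exists e%:C%C; first by rewrite /= ltcR.
move=> y; rewrite /ball /= normr_normc ltcR => h.
apply: le_lt_trans h.
have h1 := le_normcD (z - y) y; have h2 := le_normcD (y - z) z.
rewrite !subrK in h1 h2.
have h3 : Normc.normc (y - z) = Normc.normc (z - y).
  by apply: complexI; rewrite -!normr_normc distrC.
by rewrite ler_distl lerBlDl -{1}h3 h2 addrC h1.
Qed.

Lemma real_complex_continuous (R : realType) :
  continuous (fun t : R => t%:C%C : R[i]).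
Proof.
move=> t; apply: (iffRL (@cvgrPdist_lt _ _ _ _ (nbhs_filter t) _ _)).
move=> -[a b] /=.
rewrite ltcE /= => /andP[/eqP -> a0].
apply/nbhs_ballP; exists a => // s /=; rewrite /ball /= => ts.
by rewrite -rmorphB normr_normc normc_real ltcR.
Qed.

Lemma enorm_ge0 (R : realType) n (z : 'rV[R[i]]_n) : 0 <= enorm z.
Proof. exact: sqrtr_ge0. Qed.

Lemma enorm_sqr (R : realType) n (z : 'rV[R[i]]_n) :
  enorm z ^+ 2 = \sum_(j < n) Normc.normc (z ord0 j) ^+ 2.
Proof. by rewrite sqr_sqrtr // sumr_ge0 // => j _; exact: sqr_ge0. Qed.

Lemma normc_le_enorm (R : realType) n (z : 'rV[R[i]]_n) j :
  Normc.normc (z ord0 j) <= enorm z.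
Proof.
rewrite -(ler_pXn2r (n := 2)) ?nnegrE ?normc_ge0 ?enorm_ge0 //.
rewrite enorm_sqr (bigD1 j) //= lerDl sumr_ge0 // => i _; exact: sqr_ge0.
Qed.

Lemma enormZ (R : realType) n (c : R[i]) (z : 'rV[R[i]]_n) :
  enorm (c *: z) = Normc.normc c * enorm z.
Proof.
apply/eqP; rewrite -(eqrXn2 (n := 2)) ?mulr_ge0 ?normc_ge0 ?enorm_ge0 //.
rewrite exprMn !enorm_sqr mulr_sumr; apply/eqP/eq_bigr => j _.
by rewrite mxE Normc.normcM exprMn.
Qed.

Lemma meval_continuous (T : topologicalType) (K : numFieldType) n
    (v : T -> 'I_n -> K) (q : mpoly n K) :
  (forall j, continuous (fun t => v t j)) ->
  continuous (fun t => meval (v t) q).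
Proof.
move=> cv; under eq_fun do rewrite mevalE.
apply: (continuous_big (@add_continuous K)) => m _ t.
apply: cvgM; first exact: cvg_cst.
apply: (cvg_big (@mul_continuous K)) => j _.
elim: (fun_of_multinom m j) => [|k IHk]; first exact: cvg_cst.
under eq_fun do rewrite exprS.
by rewrite exprS; apply: cvgM => //; exact: cv.
Qed.

Lemma row_continuous (T : topologicalType) (K : numFieldType) n
    (f : T -> 'rV[K]_n) :
  (forall j, continuous (fun t => f t ord0 j)) -> continuous f.
Proof.
move=> cf t A [P Pf PA].
have : \forall s \near t, forall ij : 'I_1 * 'I_n, P ij.1 ij.2 (f s ij.1 ij.2).
  apply: filter_forall => -[i j] /=; rewrite (ord1 i).
  exact: (cf j t _ (Pf ord0 j)).
by apply: filterS => s Ps; apply: (PA (f s)) => i j; exact: (Ps (i, j)).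
Qed.

Lemma enorm_continuous (R : realType) n : continuous (@enorm R n).
Proof.
have cn j : continuous (fun z : 'rV[R[i]]_n => Normc.normc (z ord0 j)).
  move=> z; apply: (continuous_comp (f := fun z : 'rV[R[i]]_n => z ord0 j)).
    exact: (@coord_continuous R[i]).
  exact: normc_continuous.
move=> z; apply: continuous_comp (@sqrt_continuous _ _).
apply: (continuous_big (@add_continuous R)) => j _ x.
exact: (continuous_comp (cn j x) (@exprn_continuous R 2 _)).
Qed.

Lemma polymap_continuous (R : realType) n N (p : 'I_N -> mpoly n R[i]) :
  continuous (polymap p).
Proof.
apply: (@row_continuous _ R[i]) => i.
under eq_fun do rewrite mxE.
apply: (@meval_continuous _ R[i]) => j; exact: (@coord_continuous R[i]).
Qed.

(** * Restriction of a polynomial map to complex lines through the origin *)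

Lemma meval_dhomogZ (K : comNzRingType) n (q : mpoly n K) k (c : K)
    (v : 'I_n -> K) :
  q \is ishomog1 k mdeg ->
  meval (fun j => c * v j) q = c ^+ k * meval v q.
Proof.
move/dhomogP => hq; rewrite !mevalE mulr_sumr; apply: eq_big_seq => m mq.
under eq_bigr do rewrite exprMn.
rewrite big_split /= prodrXr -mdegE (hq m mq) mulrCA; congr (_ * _).
Qed.

Lemma polymap_hompartZ (R : realType) n N (p : 'I_N -> mpoly n R[i]) k
    (c : R[i]) (z : 'rV[R[i]]_n) :
  polymap (hompart k p) (c *: z) = c ^+ k *: polymap (hompart k p) z.
Proof.
apply/rowP => i; rewrite !mxE -meval_dhomogZ; last exact: pihomogP.
by apply: meval_eq => j; rewrite mxE.
Qed.

Lemma polymap_line (R : realType) n N (p : 'I_N -> mpoly n R[i])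
    (c : R[i]) (z : 'rV[R[i]]_n) i :
  polymap p (c *: z) ord0 i =
  (\poly_(k < (pdeg p).+1) polymap (hompart k p) z ord0 i).[c].
Proof.
rewrite polymap_hompart summxE horner_poly; apply: eq_bigr => k _.
by rewrite polymap_hompartZ mxE mulrC.
Qed.

(** Reversing and conjugating the coefficients turns the antiholomorphic reflection
    [x |-> (x^*%R)^-1], up to the factor [x ^+ d], into a genuine polynomial in [x]. *)
Lemma horner_conj_rev (K : numClosedFieldType) d (a : nat -> K) (x : K) :
  x != 0 ->
  (\poly_(k < d.+1) (a (d - k)%N)^*%R).[x] =
  x ^+ d * ((\poly_(k < d.+1) a k).[(x^*%R)^-1])^*%R.
Proof.
move=> x0; rewrite !horner_poly rmorph_sum mulr_sumr /=.
rewrite (reindex_inj rev_ord_inj) /=; apply: eq_bigr => k _.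
rewrite subSS subKn ?leq_ord // rmorphM rmorphXn fmorphV /= conjCK.
by rewrite exprB ?unitfE ?leq_ord // exprVn mulrCA.
Qed.

(** * The reflection identity in the unit circle *)

(** A Cayley transform of the integers: a quotient of conjugates has modulus 1, which gives
    infinitely many explicit points of the circle. *)
Definition circle_pt (R : realType) (m : nat) : R[i] :=
  ((m%:R +i* 1) / (m%:R -i* 1))%C.

Lemma circle_pt_norm (R : realType) m : `|circle_pt R m| = 1.
Proof.
have x0 : (m%:R +i* 1)%C != 0 :> R[i] by rewrite eq_complex /= oner_eq0 andbF.
rewrite /circle_pt normf_div (normcJ (m%:R +i* 1)%C).
by rewrite divff // normr_eq0.
Qed.

Lemma circle_pt_inj (R : realType) : injective (@circle_pt R).
Proof.
move=> m k /eqP.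
have x0 j : (j%:R -i* 1)%C != 0 :> R[i].
  by rewrite eq_complex /= oppr_eq0 oner_eq0 andbF.
(* After cross-multiplication the imaginary parts read [k - m = m - k]. *)
rewrite /circle_pt eqr_div // eq_complex /= => /andP[_ /eqP h].
apply/eqP; rewrite -(eqr_nat R); apply/eqP.
move: h; rewrite !mulrN !mulr1 !mul1r => h; lra.
Qed.

(** A nonzero [q] has fewer than [size q] distinct roots, but the circle supplies [size q] of
    them. *)
Lemma poly_eq0_circle (R : realType) (q : {poly R[i]}) :
  (forall x : R[i], `|x| = 1 -> q.[x] = 0) -> q = 0.
Proof.
move=> hq; apply/eqP; apply: contraT => q0.
have := @max_poly_roots _ q (map (@circle_pt R) (iota 0 (size q))) q0.
rewrite size_map size_iota ltnn; apply.
  apply/allP => _ /mapP[m _ ->]; apply/eqP/hq; exact: circle_pt_norm.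
by rewrite map_inj_uniq ?iota_uniq //; exact: circle_pt_inj.
Qed.

Lemma enorm_sqrC (R : realType) n (z : 'rV[R[i]]_n) :
  ((enorm z) ^+ 2)%:C%C = \sum_i z ord0 i * (z ord0 i)^*%R.
Proof.
rewrite enorm_sqr rmorph_sum; apply: eq_bigr => i _.
by rewrite -normCK normr_normc rmorphXn.
Qed.

Lemma polymap_reflection (R : realType) n N (p : 'I_N -> mpoly n R[i])
    (u : 'rV[R[i]]_n) (c : R[i]) :
  (forall z, usphere z -> usphere (polymap p z)) -> usphere u -> c != 0 ->
  \sum_i polymap p (c *: u) ord0 i * (polymap p ((c^*%R)^-1 *: u) ord0 i)^*%R
    = 1.
Proof.
move=> ps us c0; set d := pdeg p.
pose a i k := polymap (hompart k p) u ord0 i.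
(* Away from 0, [F] is the desired identity multiplied by [x ^+ d], hence polynomial. On the circle
   the reflection fixes [x], so the sum is the squared norm of [p] at a point of the sphere and [F]
   vanishes. *)
pose F : {poly R[i]} := \sum_i (\poly_(k < d.+1) a i k) *
  (\poly_(k < d.+1) (a i (d - k)%N)^*%R) - 'X^d.
have FE (x : R[i]) : x != 0 -> F.[x] =
    x ^+ d * (\sum_i polymap p (x *: u) ord0 i *
              (polymap p ((x^*%R)^-1 *: u) ord0 i)^*%R - 1).
  move=> x0; rewrite hornerD hornerN hornerXn mulrBr mulr1 horner_sum mulr_sumr.
  congr (_ - _); apply: eq_bigr => i _.
  by rewrite hornerM horner_conj_rev // !polymap_line mulrCA.
suff /(congr1 (fun q : {poly R[i]} => q.[c])) : F = 0.
  rewrite FE // horner0 => /eqP; rewrite mulf_eq0 expf_eq0 (negbTE c0) andbF /=.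
  by rewrite subr_eq0 => /eqP.
apply: poly_eq0_circle => x x1.
have x0 : x != 0 by rewrite -normr_eq0 x1 oner_eq0.
have xV : (x^*%R)^-1 = x.
  apply: (mulIf (x := x^*%R)); first by rewrite conjC_eq0.
  by rewrite mulVf ?conjC_eq0 // -normCK x1 expr1n.
rewrite FE // xV -enorm_sqrC.
have -> : enorm (polymap p (x *: u)) = 1.
  apply: ps; rewrite /usphere /= enormZ us mulr1.
  by apply: complexI; rewrite -normr_normc x1.
by rewrite expr1n subrr mulr0.
Qed.

(** Each of the [N] summands of the reflection identity is at most the product of the two norms;
    this crude form of Cauchy-Schwarz costs the factor [N]. *)
Lemma enorm_reflection (R : realType) n N (p : 'I_N -> mpoly n R[i])
    (u : 'rV[R[i]]_n) (t : R) :
  (forall z, usphere z -> usphere (polymap p z)) -> usphere u -> t != 0 ->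
  1 <= N%:R * (enorm (polymap p (t%:C%C *: u)) *
               enorm (polymap p (t^-1%:C%C *: u))).
Proof.
move=> ps us t0.
have t0C : t%:C%C != 0 :> R[i] by rewrite eq_complex /= (negbTE t0).
have := polymap_reflection ps us t0C.
(* A real [t] is its own conjugate, so the reflected parameter is [t^-1]. *)
rewrite -[(t%:C%C)^*%R]/((t%:C%C)^*)%C conjc_real -fmorphV /= => h.
have : `|1| <= \sum_(i < N) (enorm (polymap p (t%:C%C *: u)) *
               enorm (polymap p (t^-1%:C%C *: u)))%:C%C :> R[i].
  rewrite -{1}h; apply: le_trans (ler_norm_sum _ _ _) _; apply: ler_sum => i _.
  rewrite normrM norm_conjC !normr_normc -rmorphM lecR.
  by apply: ler_pM; rewrite ?normc_ge0 ?normc_le_enorm.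
by rewrite normr1 sumr_const card_ord -rmorphMn lecR /= mulr_natl.
Qed.

(** * Boundary values of a proper map *)

Lemma line_continuous (R : realType) n (z : 'rV[R[i]]_n) :
  continuous (fun t : R => t%:C%C *: z).
Proof.
apply: (@row_continuous _ R[i]) => j.
under eq_fun do rewrite mxE.
move=> t; apply: cvgM; last exact: cvg_cst.
exact: real_complex_continuous.
Qed.

(* The image under [p] of the radius ending at [u] is compact; if it stayed
   in the open ball, its preimage would be a closed subset of the open ball
   accumulating at [u]. *)
Lemma proper_usphere (R : realType) n N (p : 'I_N -> mpoly n R[i]) :
  proper_map (@uball R n) (@uball R N) (polymap p) ->
  forall u, usphere u -> usphere (polymap p u).
Proof.
move=> [_ pball pK] u us.
pose g (t : R) := polymap p (t%:C%C *: u).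
have gc : continuous g.
  move=> t; apply: continuous_comp; first exact: line_continuous.
  exact: polymap_continuous.
have ngc : continuous (fun t => enorm (g t)).
  by move=> t; apply: continuous_comp; [exact: gc|exact: enorm_continuous].
have g1 : g 1 = polymap p u by rewrite /g rmorph1 scale1r.
have inball t : 0 <= t < 1 -> uball (t%:C%C *: u).
  move=> /andP[t0 t1].
  by rewrite /uball /= enormZ us mulr1 normc_real ger0_norm.
(* Whatever holds near the endpoint 1 of the radius already holds at some interior parameter. *)
have left (P : R -> Prop) :
    (\forall t \near (1 : R), P t) -> exists2 t, 0 <= t < 1 & P t.
  move=> nP; have : \forall t \near (1 : R)^'-, 0 <= t < 1 /\ P t.
    near=> t; split; last by near: t; exact: cvg_within nP.
    by apply/andP; split; near: t; [exact: nbhs_left_ge|exact: nbhs_left_lt].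
  by move=> /filter_ex[t [t01 Pt]]; exists t.
rewrite /usphere /= -g1; apply/eqP; rewrite eq_le; apply/andP; split.
  (* A norm above 1 at [u] would persist inside the ball, which [p] maps into the ball. *)
  rewrite leNgt; apply/negP => g1gt.
  have [t /inball/pball] := left _ (cvgr_gt _ (ngc 1) _ g1gt).
  by rewrite /uball /= => h1 h2; have := lt_trans h1 h2; rewrite ltxx.
rewrite leNgt; apply/negP => g1lt.
pose K := g @` `[0, 1].
have Kc : compact K.
  apply: continuous_compact; last exact: segment_compact.
  exact: continuous_subspaceT.
have KB : K `<=` @uball R N.
  move=> _ [t /= + <-]; rewrite in_itv /= => /andP[t0].
  rewrite le_eqVlt => /predU1P[->//|t1]; apply/pball/inball.
  by rewrite t0.
have Lcl := compact_closed (@norm_hausdorff _ _) (pK K KB Kc).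
have /Lcl[] : closure (@uball R n `&` polymap p @^-1` K) u; last first.
  by rewrite /uball /= us ltxx.
move=> B uB; have [|t t01 Bt] := left (fun t => B (t%:C%C *: u)).
  by apply: line_continuous; rewrite rmorph1 scale1r.
exists (t%:C%C *: u); split => //; split; first exact: inball.
exists t => //=; rewrite in_itv /=.
by case/andP: t01 => -> /ltW ->.
Unshelve. all: by end_near. Qed.

(** * Compactness of the sphere and the sum norm *)

(** The sphere is closed in a finite product of compact squares [D], since real and imaginary parts
    of each coordinate lie in [-1, 1]. *)
Lemma usphere_compact (R : realType) n : compact (@usphere R n).
Proof.
pose D := (fun ab : R * R => (ab.1 +i* ab.2)%C : R[i]) @`
  (`[-1, 1] `*` `[-1, 1]).
have Dc : compact D.
  apply: continuous_compact; last first.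
    by apply: compact_setX; exact: segment_compact.
  apply: continuous_subspaceT.
  have -> : (fun ab : R * R => (ab.1 +i* ab.2)%C : R[i]) =
     (fun ab => ab.1%:C%C + 'i%C * ab.2%:C%C).
    by apply/funext => -[a b] /=; simpc.
  move=> ab; apply: cvgD.
    by apply: continuous_comp; [exact: cvg_fst|exact: real_complex_continuous].
  apply: cvgM; first exact: cvg_cst.
  by apply: continuous_comp; [exact: cvg_snd|exact: real_complex_continuous].
apply: subclosed_compact (rV_compact (fun _ : 'I_n => Dc)) _.
  rewrite (_ : @usphere R n = @enorm R n @^-1` [set 1]) //.
  apply: preimage_closed; last exact: closed_eq.
  by move=> z _; exact: enorm_continuous.
move=> z zs j /=; exists (complex.Re (z ord0 j), complex.Im (z ord0 j));
  last by case: (z ord0 j).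
have := normc_le_enorm z j; rewrite zs.
case: (z ord0 j) => a b /= nab.
have : a ^+ 2 + b ^+ 2 <= 1 by move: nab; rewrite -{1}sqrtr1 ler_sqrt ?ler01.
move=> h; split; rewrite /= in_itv /= -ler_norml.
all: by rewrite -(@expr_le1 _ 2) ?normr_ge0 // real_normK ?num_real //;
  apply: le_trans h; rewrite ?lerDl ?lerDr sqr_ge0.
Qed.

(** The l1 norm: its triangle inequality is coordinatewise, and it is comparable to [enorm], which
    suffices for growth estimates. *)
Definition snorm (R : realType) n (z : 'rV[R[i]]_n) : R :=
  \sum_j Normc.normc (z ord0 j).

Lemma snorm_ge0 (R : realType) n (z : 'rV[R[i]]_n) : 0 <= snorm z.
Proof. by apply: sumr_ge0 => j _; exact: normc_ge0. Qed.

Lemma snorm_gt0 (R : realType) n (z : 'rV[R[i]]_n) : z <> 0 -> 0 < snorm z.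
Proof.
move=> z0; rewrite lt_def snorm_ge0 andbT; apply/eqP => s0; apply: z0.
apply/rowP => j; rewrite mxE; apply: Normc.eq0_normc.
by apply: (psumr_eq0P _ s0) => // i _; exact: normc_ge0.
Qed.

Lemma snormD (R : realType) n (y z : 'rV[R[i]]_n) :
  snorm (y + z) <= snorm y + snorm z.
Proof.
rewrite /snorm -big_split /=; apply: ler_sum => j _; rewrite mxE.
exact: le_normcD.
Qed.

Lemma snormZ (R : realType) n (c : R[i]) (z : 'rV[R[i]]_n) :
  snorm (c *: z) = Normc.normc c * snorm z.
Proof.
by rewrite /snorm mulr_sumr; apply: eq_bigr => j _; rewrite mxE Normc.normcM.
Qed.

Lemma snorm_le_enorm (R : realType) n (z : 'rV[R[i]]_n) :
  snorm z <= n%:R * enorm z.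
Proof.
apply: (@le_trans _ _ (\sum_(j < n) enorm z)).
  by apply: ler_sum => j _; exact: normc_le_enorm.
by rewrite sumr_const card_ord mulr_natl.
Qed.

Lemma snorm_continuous (R : realType) n : continuous (@snorm R n).
Proof.
apply: (continuous_big (@add_continuous R)) => j _ z.
apply: (continuous_comp (f := fun z : 'rV[R[i]]_n => z ord0 j)).
  exact: (@coord_continuous R[i]).
exact: normc_continuous.
Qed.

Lemma nbhs0_enorm (R : realType) n (P : 'rV[R[i]]_n -> Prop) :
  (\forall z \near (0 : 'rV[R[i]]_n), P z) ->
  exists2 r : R, 0 < r & forall z, enorm z < r -> P z.
Proof.
case=> B nB BP.
have : \forall x \near (0 : R[i]), forall j, B ord0 j x.
  apply: (@filter_forall _ _ _ _ (nbhs_filter (0 : R[i]))) => j.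
  by have := nB ord0 j; rewrite mxE.
move=> /nbhs_ballP[[a b]]; rewrite /= ltcE /= => /andP[/eqP -> a0] aB.
exists a => // z za; apply: BP => i j; rewrite (ord1 i); apply: aB.
rewrite /ball /= sub0r normrN normr_normc ltcR.
exact: le_lt_trans (normc_le_enorm z j) za.
Qed.

Lemma usphere_normalize (R : realType) n (z : 'rV[R[i]]_n) :
  0 < enorm z -> exists2 u, usphere u & z = (enorm z)%:C%C *: u.
Proof.
move=> z0; have z0C : (enorm z)%:C%C != 0 :> R[i].
  by rewrite eq_complex /= (gt_eqF z0).
exists ((enorm z)%:C%C^-1 *: z); last by rewrite scalerA divff // scale1r.
rewrite /usphere /= enormZ Normc.normcV normc_real ger0_norm ?(ltW z0) //.
by rewrite mulVf // gt_eqF.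
Qed.

(** * Growth at infinity in the two cases *)

Lemma enorm_cvgy_of_zero (R : realType) n N (p : 'I_N -> mpoly n R[i]) :
  (forall z, usphere z -> usphere (polymap p z)) -> polymap p 0 = 0 ->
  enorm (polymap p z) @[z --> @at_infinity R n] --> +oo.
Proof.
move=> ps p0; apply/cvgryPge => A.
pose B := `|A| + 1.
have B0 : 0 < B by rewrite ltr_wpDl.
(* With this bound on the reflected value, [enorm (polymap p z) <= B] would give [1 <= N / (N + 1)].
   Using [N.+1] also keeps the inverse meaningful for [N = 0]. *)
have e0 : 0 < (N.+1%:R * B)^-1 by rewrite invr_gt0 mulr_gt0.
have [|r r0 hr] := @nbhs0_enorm R n
    (fun w => enorm (polymap p w) < (N.+1%:R * B)^-1).
  have c0 : {for (0 : 'rV[R[i]]_n), continuous (fun w => enorm (polymap p w))}.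
    apply: continuous_comp; first exact: polymap_continuous.
    exact: enorm_continuous.
  apply: (cvgr_lt _ c0); rewrite p0.
  by rewrite -(scale0r (0 : 'rV[R[i]]_N)) enormZ Normc.normc0 mul0r.
exists r^-1 => // z /= rz.
have z0 : 0 < enorm z by apply: lt_trans rz; rewrite invr_gt0.
have [u us zE] := usphere_normalize z0.
have := enorm_reflection ps us (lt0r_neq0 z0); rewrite -zE.
set b := enorm (polymap p (_ *: u)) => h.
have b_lt : b < (N.+1%:R * B)^-1.
  apply: hr; rewrite enormZ us mulr1 normc_real.
  rewrite ger0_norm ?invr_ge0 ?(ltW z0) //.
  by rewrite -[r]invrK ltf_pV2 ?posrE ?invr_gt0.
rewrite leNgt; apply/negP => Alt.
have a_le : enorm (polymap p z) <= B.
  by rewrite (le_trans (ltW Alt)) // (le_trans (ler_norm A)) // lerDl.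
have : N%:R * (enorm (polymap p z) * b) <= N%:R * (B * (N.+1%:R * B)^-1).
  by rewrite ler_wpM2l // ler_pM ?enorm_ge0 // ltW.
move=> /(le_trans h); rewrite invfM [B * _]mulrCA divff ?gt_eqF // mulr1.
by rewrite ler_pdivlMr // mul1r ler_nat ltnn.
Qed.

(** A constant map would take a value of norm 1 at [u] and the same value, of norm below 1, at the
    origin. *)
Lemma pdeg_gt0 (R : realType) n N (p : 'I_N -> mpoly n R[i])
    (u : 'rV[R[i]]_n) :
  proper_map (@uball R n) (@uball R N) (polymap p) -> usphere u ->
  (0 < pdeg p)%N.
Proof.
move=> p_proper us; rewrite lt0n; apply/negP => /eqP d0.
have cstp z : polymap p z = polymap p 0.
  by rewrite !polymap_hompart d0 !big_ord1 -(scale0r z) polymap_hompartZ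
    expr0 scale1r.
have := proper_usphere p_proper us; rewrite cstp /usphere /= => e1.
have [_ pball _] := p_proper.
have /pball : uball (0 : 'rV[R[i]]_n).
  by rewrite /uball /= -(scale0r u) enormZ Normc.normc0 mul0r.
by rewrite /uball /= e1 ltxx.
Qed.

Lemma enorm_cvgy_of_lead (R : realType) n N (p : 'I_N -> mpoly n R[i])
    (u0 : 'rV[R[i]]_n) :
  usphere u0 -> (0 < pdeg p)%N ->
  (forall z, usphere z -> polymap (hompart (pdeg p) p) z <> 0) ->
  enorm (polymap p z) @[z --> @at_infinity R n] --> +oo.
Proof.
move=> u0s; set d := pdeg p => d0 lead; apply/cvgryPge => A.
pose S k z := snorm (polymap (hompart k p) z).
have Sc k : continuous (S k).
  move=> z; apply: continuous_comp; first exact: polymap_continuous.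
  exact: snorm_continuous.
have Tc : continuous (fun z => \sum_(k < d) S k z).
  by apply: (continuous_big (@add_continuous R)) => k _; exact: Sc.
have [u1 u1s mP] := @compact_EVT_min _ R (S d) _ (ex_intro _ u0 u0s)
  (@usphere_compact R n) (continuous_subspaceT (Sc d)).
have [u2 u2s MP] := @compact_EVT_max _ R _ _ (ex_intro _ u0 u0s)
  (@usphere_compact R n) (continuous_subspaceT Tc).
move: mP MP; set m := S d u1; set M := \sum_(k < d) S k u2 => mP MP.
have m0 : 0 < m by apply/snorm_gt0/lead; exact/set_mem.
exists (Num.max 1 ((M + N%:R * `|A| + 1) / m)) => // z /=.
rewrite gt_max => /andP[r1 rA].
have z0 := lt_trans ltr01 r1.
have [u us zE] := usphere_normalize z0.
move: zE r1 rA; set r := enorm z => zE r1 rA.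
have r0 : 0 <= r := ltW z0.
have normr k : Normc.normc (r%:C%C ^+ k) = r ^+ k.
  by rewrite -rmorphXn normc_real ger0_norm // exprn_ge0.
have key : r ^+ d.-1 * (r * m - M) <= snorm (polymap p z).
  have : snorm (r%:C%C ^+ d *: polymap (hompart d p) u) <=
      snorm (polymap p z) + r ^+ d.-1 * M.
    rewrite -polymap_hompartZ -zE.
    (* The leading part is [p] minus the lower parts, so the triangle inequality bounds
       [snorm (polymap p z)] from below. *)
    have -> : polymap (hompart d p) z =
        polymap p z + - \sum_(k < d) polymap (hompart k p) z.
      rewrite [polymap p z]polymap_hompart big_ord_recr /=.
      by rewrite addrAC subrr add0r.
    apply: le_trans (snormD _ _) _; rewrite lerD2l.
    rewrite -scaleN1r snormZ -[X in Normc.normc X]/(-1).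
    rewrite (_ : Normc.normc _ = 1) ?mul1r; last first.
      by apply: complexI; rewrite -normr_normc normrN1.
    apply: (@le_trans _ _ (\sum_(k < d) r ^+ d.-1 * S k u)).
      apply: (@le_trans _ _ (\sum_(k < d) snorm (polymap (hompart k p) z))).
        elim/big_ind2 : _ => [|x1 x2 y1 y2 h1 h2|//].
          by rewrite -(scale0r (0 : 'rV[R[i]]_N)) snormZ Normc.normc0 mul0r.
        by apply: le_trans (snormD _ _) _; exact: lerD.
      apply: ler_sum => k _; rewrite zE polymap_hompartZ snormZ normr.
      rewrite ler_wpM2r ?snorm_ge0 // ler_weXn2l ?(ltW r1) //.
      by rewrite -ltnS prednK.
    rewrite -mulr_sumr ler_wpM2l ?exprn_ge0 //; apply: MP; exact/mem_set.
  rewrite snormZ normr -[in r ^+ d](prednK d0) exprSr => h.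
  rewrite mulrBr lerBlDr mulrA; apply: le_trans h.
  by rewrite ler_wpM2l ?mulr_ge0 ?exprn_ge0 //; apply: mP; exact/mem_set.
have big : N%:R * `|A| + 1 <= r * m - M.
  by rewrite lerBrDl addrA -ler_pdivrMr // ltW.
rewrite leNgt; apply/negP => Alt.
have : N%:R * `|A| + 1 <= N%:R * `|A|.
  apply: (le_trans big); apply: (@le_trans _ _ (N%:R * enorm (polymap p z))).
    apply: le_trans (snorm_le_enorm _); apply: le_trans key.
    rewrite ler_peMl ?exprn_ege1 ?(ltW r1) //.
    by apply: le_trans big; rewrite addr_ge0 // mulr_ge0.
  by rewrite ler_wpM2l // (le_trans (ltW Alt)) // ler_norm.
by rewrite gerDl leNgt ltr01.
Qed.

Theorem proposition2p2 (R : realType) (n N : nat) (p : 'I_N -> mpoly n R[i])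
    (p_proper : proper_map (@uball R n) (@uball R N) (polymap p))
    (p_cases : polymap p 0 = 0 \/
      (forall z, usphere z -> polymap (hompart (pdeg p) p) z <> 0)) :
  enorm (polymap p z) @[z --> @at_infinity R n] --> +oo.
Proof.
case: p_cases => [p0|lead].
  exact: enorm_cvgy_of_zero (proper_usphere p_proper) p0.
have [[u us]|noS] := pselect (@usphere R n !=set0).
  exact: enorm_cvgy_of_lead us (pdeg_gt0 p_proper us) lead.
(* An empty sphere ([n = 0]) leaves no vector of positive norm, so the claim is vacuous beyond
   radius 0. *)
apply/cvgryPge => A; exists 0 => // z /= z0.
have [u us _] := usphere_normalize z0.
by exfalso; apply: noS; exists u.
Qed.
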